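(* For each positive integer $n$, let $k_n$ be a positive integer and let $E_n\subseteq\mathbb{N}$ be a set of cardinality $n$ which is a union of $k_n$ intervals of integers. Let $r_n$ denote the maximal cardinality of a Sidon set contained in $E_n$. Then, as $n\to\infty$: (i) if $\limsup_{n\to\infty} k_n/\sqrt{n}=\alpha$ for some real number $\alpha>0$, then $r_n\leqslant \left(\alpha+\sqrt{2+\alpha^2}\right)\sqrt{n}+o(\sqrt{n})$; (ii) if $k_n=o(\sqrt{n})$, then $r_n\leqslant \sqrt{n}+o(\sqrt{n})$; (iii) if $k_n=o(n^{1/4})$, then $r_n\leqslant \sqrt{n}+\sqrt{k_n}\,n^{1/4}+o(n^{1/4})$.
   Context: A Sidon set is a set $S$ of integers such that whenever $a,b,c,d\in S$ satisfy $a+b=c+d$, we have $\{a,b\}=\{c,d\}$ (i.e. all sums of two elements of $S$ are distinct). An interval of integers means a set of the form $\{a,a+1,\dots,b\}$. The $o(\cdot)$ terms are with respect to $n\to\infty$ and depend only on $n$ (uniform over the choice of the sets $E_n$ satisfying the hypotheses). *)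

(* Defs.v *)
From HB Require Import structures.
From mathcomp Require Export all_boot all_order all_algebra finmap.
From mathcomp Require Export all_classical all_reals all_analysis.

Set Implicit Arguments.
Unset Strict Implicit.
Unset Printing Implicit Defensive.

Local Open Scope fset_scope.

Definition sidon (S : {fset nat}) : Prop :=
  forall a b c d : nat, a \in S -> b \in S -> c \in S -> d \in S ->
    (a + b = c + d)%N -> [fset a; b] = [fset c; d].

Definition max_sidon_card (E : {fset nat}) : nat :=
  \max_(S <- fpowerset E | `[< sidon S >]) #|` S|.

(* The interval {a i, ..., b i} is nonempty; distinct indices may give
   overlapping or equal intervals. *)
Definition union_of_intervals (k : nat) (E : {fset nat}) : Prop :=
  exists a b : 'I_k -> nat,
    (forall i, (a i <= b i)%N) /\
    (forall x : nat, x \in E <-> exists i, (a i <= x <= b i)%N).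

(* The index n = 0 is left unconstrained: the sequences start at n = 1. *)
Definition interval_union_sequence (k : nat -> nat) (E : nat -> {fset nat})
  : Prop :=
  forall n, (0 < n)%N -> #|` E n| = n /\ union_of_intervals (k n) (E n).

(* Main.v *)
(** Let [S] be a Sidon subset of [E] with [r] elements and let [u > 0]. The sums
    [x + i] with [x] in [S] and [i < u] lie in [E + [0, u)], which has at most
    [n + k (u - 1)] elements. Two of them collide either trivially or in a way
    determined by the two distinct shifts, because the differences of [S] are
    distinct; so there are at most [r u + u (u - 1)] collisions, and
    Cauchy-Schwarz gives [u r^2 <= (n + k (u - 1)) (r + u - 1)]. Hence
    [r^2 <= n + k v + r (n / v + k)] for every real [v > 0]. Part (i) takes
    [v = sqrt n / alpha]; parts (ii) and (iii) take [v = n^(3/4) / sqrt k],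
    which gives [r <= sqrt n + sqrt k n^(1/4) + k]. *)

Require Import Defs.
From HB Require Import structures.
From mathcomp Require Import all_boot all_order all_algebra finmap.
From mathcomp Require Import all_classical all_reals all_analysis.
From mathcomp Require Import zify ring lra.

Set Implicit Arguments.
Unset Strict Implicit.
Unset Printing Implicit Defensive.

Import Order.TTheory GRing.Theory Num.Theory.
Import numFieldNormedType.Exports.


(** * Cauchy-Schwarz for collisions of a map *)

Lemma sum_sqr_le_card (Y : finType) (a : Y -> nat) :
  ((\sum_y a y) ^ 2 <= #|Y| * \sum_y a y ^ 2)%N.
Proof.
(* After doubling, both sides are double sums compared termwise by 2ab <= a^2 + b^2. *)
rewrite -(leq_pmul2l (isT : 0 < 2)%N) expnS expn1 big_distrlr /= big_distrr /=.
apply: (@leq_trans (\sum_y \sum_z (a y ^ 2 + a z ^ 2)))%N.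
  apply: leq_sum => y _; rewrite big_distrr /=; apply: leq_sum => z _.
  exact: nat_Cauchy.
under eq_bigr do rewrite big_split /= sum_nat_const.
by rewrite big_split /= sum_nat_const -big_distrr /= addnn -mul2n.
Qed.

(** The fibre sizes of [g] add up to the size of [X], and their squares to the number of colliding
    pairs. *)
Lemma card_sqr_le_collisions (X Y : finType) (g : X -> Y) :
  (#|X| ^ 2 <= #|Y| * #|[set p : X * X | g p.1 == g p.2]|)%N.
Proof.
have fiberE : #|X| = (\sum_y \sum_(x | g x == y) 1)%N.
  by rewrite -sum1_card (partition_big g predT).
have -> : #|[set p : X * X | g p.1 == g p.2]|
          = (\sum_y (\sum_(x | g x == y) 1) ^ 2)%N.
  rewrite -sum1_card (partition_big (fun p : X * X => g p.1) predT) //=.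
  apply: eq_bigr => y _; rewrite expnS expn1 big_distrlr /= pair_big /=.
  apply: eq_bigl => -[x x'] /=; rewrite inE /=.
  by apply/andP/andP=> -[/eqP h /eqP h']; split; apply/eqP; congruence.
by rewrite {1}fiberE; exact: sum_sqr_le_card.
Qed.

(** * Sidon sets and sumsets with an initial segment *)

Section Combinatorics.
Local Open Scope fset_scope.
Local Open Scope nat_scope.

Definition thicken (E : {fset nat}) (u : nat) : {fset nat} :=
  [fset x + i | x in E, i in iota 0 u].

Lemma mem_thicken (E : {fset nat}) u x i :
  x \in E -> i < u -> x + i \in thicken E u.
Proof.
by move=> xE iu; apply/imfset2P; exists x => //; exists i; rewrite //= mem_iota.
Qed.

(** Each further shift adds at most one new point per interval, just past its shifted right end. *)
Lemma card_thicken k (E : {fset nat}) u : union_of_intervals k E ->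
  #|` thicken E u.+1| <= #|` E| + k * u.
Proof.
move=> [a [b [leab memE]]]; elim: u => [|u IHu].
  rewrite muln0 addn0; apply: fsubset_leq_card; apply/fsubsetP => y.
  move=> /imfset2P[x xE [i]]; rewrite mem_iota => /andP[_].
  by rewrite add0n ltnS leqn0 => /eqP-> ->; rewrite addn0.
have sub : thicken E u.+2 `<=`
    thicken E u.+1 `|` [fset b i + u.+1 | i in 'I_k].
  apply/fsubsetP => y /imfset2P[x xE [j]].
  rewrite mem_iota add0n => /andP[_ ju] ->; rewrite inE.
  move: ju; rewrite ltnS leq_eqVlt => /orP[/eqP->|ju]; last by rewrite mem_thicken.
  have [i /andP[aix]] := (memE x).1 xE.
  rewrite leq_eqVlt => /orP[/eqP->|xbi].
    by apply/orP; right; apply/imfsetP; exists i.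
  (* Here [x < b i], so one unit moves from the shift to [x] without leaving the interval. *)
  rewrite -addSnnS mem_thicken //; apply/memE; exists i.
  by rewrite xbi (leq_trans aix).
apply: leq_trans (fsubset_leq_card sub) _.
have := cardfsUI (thicken E u.+1) [fset b i + u.+1 | i in 'I_k].
have : #|` [fset b i + u.+1 | i in 'I_k]| <= k.
  by apply: leq_trans (leq_imfset_card _ _ _) _; rewrite -cardE card_ord.
by rewrite mulnS; lia.
Qed.

(* A collision x + i = y + j with x <> y is determined by (i, j), which is off
   the diagonal, since the differences of a Sidon set are distinct. *)
Lemma sidon_collisions (S : {fset nat}) u : sidon S ->
  #|[set p : (S * 'I_u) * (S * 'I_u) |
      val p.1.1 + p.1.2 == val p.2.1 + p.2.2]| <= u * (#|` S| + u.-1).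
Proof.
move=> sidS; pose X := (S * 'I_u)%type.
pose D := [set p : X * X | p.1 == p.2].
pose C := [set p : X * X | val p.1.1 + p.1.2 == val p.2.1 + p.2.2].
pose O := [set p : 'I_u * 'I_u | p.1 != p.2].
have cD : #|D| <= #|` S| * u.
  have -> : D = [set (x, x) | x : X].
    apply/setP => -[x y]; rewrite inE /=; apply/eqP/imsetP => [->|[z _ [-> ->]] //].
    by exists y.
  by apply: leq_trans (leq_imset_card _ _) _; rewrite card_prod card_ord -cardfE.
have cO : #|O| <= u * u.-1.
  have -> : O = ~: [set (i, i) | i : 'I_u].
    apply/setP => -[i j]; rewrite !inE /=; congr (~~ _).
    by apply/eqP/imsetP => [->|[z _ [-> ->]] //]; exists j.
  rewrite cardsCs finset.setCK card_prod card_imset ?card_ord; last by move=> i j [].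
  by nia.
have CD : #|C :\: D| <= #|O|.
  pose h (p : X * X) := (p.1.2, p.2.2).
  have <- : #|h @: (C :\: D)| = #|C :\: D|.
    apply: card_in_imset => -[[x i] [y j]] [[x' i'] [y' j']].
    rewrite !inE /= => /andP[nD /eqP e] /andP[nD' /eqP e'] [ei ej].
    move: nD nD' e e'; rewrite -ei -ej => nD nD' e e'.
    have nxy : fsval x != fsval y.
      apply: contraNneq nD => xy; apply/eqP; congr pair; first exact: val_inj.
      by apply: val_inj => /=; move: e; rewrite xy => /addnI.
    (* Equal shifts in both collisions give x - y = x' - y', that is x + y' = x' + y. *)
    have E : [fset fsval x; fsval y'] = [fset fsval x'; fsval y].
      by apply: sidS; rewrite ?fsvalP //; lia.
    have xx' : fsval x = fsval x'.
      have : fsval x \in [fset fsval x'; fsval y] by rewrite -E !inE eqxx.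
      by rewrite !inE (negbTE nxy) orbF => /eqP.
    have yy' : fsval y = fsval y' by lia.
    by rewrite (val_inj xx') (val_inj yy').
  apply: subset_leq_card; apply/fintype.subsetP => _ /imsetP[[[x i] [y j]] + ->].
  rewrite !inE /= => /andP[nD /eqP e]; apply: contraNneq nD => /= ij.
  apply/eqP; rewrite ij; congr pair; apply: val_inj => /=.
  by move: e; rewrite ij => /addIn.
rewrite -/C -(cardsID D C) mulnDr.
apply: leq_add; last exact: leq_trans CD cO.
by apply: leq_trans (subset_leq_card (finset.subsetIr _ _)) _; rewrite mulnC.
Qed.

(** The collision inequality for the map [(x, i)] to [x + i], with one factor [u] cancelled. *)
Lemma sidon_card_thicken (S E : {fset nat}) u : sidon S -> S `<=` E -> 0 < u ->
  #|` S| ^ 2 * u <= #|` thicken E u| * (#|` S| + u.-1).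
Proof.
move=> sidS /fsubsetP SE u0.
have gP (x : S * 'I_u) : val x.1 + x.2 \in thicken E u.
  by apply: mem_thicken => //; apply: SE; exact: fsvalP.
pose g x : thicken E u := [` gP x].
have := card_sqr_le_collisions g.
have -> : [set p : (S * 'I_u) * (S * 'I_u) | g p.1 == g p.2] =
    [set p : (S * 'I_u) * (S * 'I_u) | val p.1.1 + p.1.2 == val p.2.1 + p.2.2].
  by apply/setP => p; rewrite !inE -val_eqE.
rewrite card_prod card_ord -!cardfE => /leq_trans.
move=> /(_ (#|` thicken E u| * (u * (#|` S| + u.-1)))).
rewrite leq_mul2l sidon_collisions ?orbT // => /(_ isT).
by rewrite expnMn -(mulnn u) !(mulnCA _ u) leq_pmul2l.
Qed.

Lemma max_sidon_card_attained (E : {fset nat}) :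
  exists S, [/\ S `<=` E, sidon S & #|` S| = max_sidon_card E].
Proof.
rewrite /max_sidon_card big_seq_cond.
pose K r := exists S, [/\ S `<=` E, sidon S & #|` S| = r].
apply: (big_ind K).
(* The default value 0 of the maximum is attained by the empty set. *)
- exists fset0; split; [exact: fsub0set | | by rewrite cardfs0].
  by move=> a b c d; rewrite inE.
- by move=> x y Kx Ky; rewrite /maxn; case: ifP.
by move=> S /andP[]; rewrite fpowersetE => SE /asboolP sS; exists S.
Qed.

End Combinatorics.

Local Open Scope classical_set_scope.
Local Open Scope ring_scope.

(** * Explicit real bounds from the counting inequality *)

Section Bounds.
Variable R : realType.
Implicit Types (E : {fset nat}) (v : R).

Lemma max_sidon_card_quadratic k E v : union_of_intervals k E -> 0 < v ->
  (max_sidon_card E)%:R ^+ 2 <= (#|` E|)%:R + k%:R * v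
     + (max_sidon_card E)%:R * ((#|` E|)%:R / v + k%:R).
Proof.
move=> kE v0; have [S [SE sidS cS]] := max_sidon_card_attained E.
(* Use [w + 1] shifts with [w] the floor of [v]: [w <= v] controls the term in [k], and [v < w + 1]
   the term [n / v]. *)
have := truncn_itv (ltW v0); set w := Num.truncn v => /andP[wv vw].
have := sidon_card_thicken sidS SE (ltn0Sn w).
rewrite cS /= => /leq_trans/(_ (leq_mul (card_thicken w kE) (leqnn _))).
rewrite -(ler_nat R) !(natrM, natrD, natrX).
rewrite -natr1.
move: (ler0n R (max_sidon_card E)) (ler0n R #|` E|) (ler0n R k) (ler0n R w).
move: vw wv; rewrite -natr1.
move: (max_sidon_card E)%:R (#|` E|)%:R k%:R w%:R => r n l x vx xv r0 n0 l0 x0 h.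
rewrite -(ler_pM2r (_ : 0 < x + 1)); last by lra.
apply: le_trans h _.
have nv : n <= n / v * (x + 1) by rewrite mulrAC ler_pdivlMr // ler_wpM2l // ltW.
have lv : l * x * x <= l * v * (x + 1).
  by rewrite -!mulrA ler_wpM2l // ler_pM //; lra.
have := ler_wpM2l r0 nv.
have := mulr_ge0 r0 l0.
nra.
Qed.

(* To be read with q = n^(1/4) and s = sqrt k. *)
Lemma quadratic_root_le (q s r : R) : 0 < q -> 0 < s -> 0 <= r ->
  r ^+ 2 <= q ^+ 4 + s * q ^+ 3 + r * (s * q + s ^+ 2) ->
  r <= q ^+ 2 + s * q + s ^+ 2.
Proof.
move=> q0 s0 r0 h; rewrite leNgt; apply/negP => lt.
pose t := r - q ^+ 2 - s * q.
have ts : s ^+ 2 < t by rewrite /t; lra.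
have rE : r = q ^+ 2 + s * q + t by rewrite /t; ring.
move: h; rewrite leNgt => /negP; apply; rewrite rE -subr_gt0.
have q20 : 0 < q ^+ 2 by exact: exprn_gt0.
have sq0 : 0 < s * q by exact: mulr_gt0.
have s20 : 0 < s ^+ 2 by exact: exprn_gt0.
(* As r - sq - s^2 = q^2 + (t - s^2), the terms q^4 and sq^3 cancel and only positive products
   remain. *)
rewrite (_ : _ - _ = (t - s ^+ 2) * q ^+ 2 + (t - s ^+ 2) * (s * q)
   + (t - s ^+ 2) * t + t * q ^+ 2); last by ring.
have d0 : 0 < t - s ^+ 2 by rewrite subr_gt0.
have t0 : 0 < t by exact: lt_trans ts.
by rewrite !addr_gt0 // mulr_gt0.
Qed.

Lemma powRV4_exp4 (n : nat) : ((n%:R : R) `^ 4^-1) ^+ 4 = n%:R.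
Proof. by rewrite -powR_mulrn ?powR_ge0 // -powRrM mulVf // powRr1. Qed.

Lemma powRV4_sqr (n : nat) : ((n%:R : R) `^ 4^-1) ^+ 2 = Num.sqrt n%:R.
Proof.
by rewrite -[in RHS]powRV4_exp4 (exprM _ 2 2) sqrtr_sqr ger0_norm.
Qed.

(** Serves both (ii) and (iii): the last summand [k] is the error term of (iii), the last two
    together that of (ii). *)
Lemma max_sidon_card_le k E :
  union_of_intervals k E -> (0 < k)%N -> (0 < #|` E|)%N ->
  (max_sidon_card E)%:R <= Num.sqrt (#|` E|)%:R
    + Num.sqrt k%:R * (#|` E|)%:R `^ 4^-1 + k%:R :> R.
Proof.
move=> kE k0 E0; rewrite -powRV4_sqr.
set q := _ `^ _; set s := Num.sqrt _.
have q0 : 0 < q by apply: powR_gt0; rewrite ltr0n.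
have s0 : 0 < s by rewrite sqrtr_gt0 ltr0n.
have s2 : s ^+ 2 = k%:R by rewrite sqr_sqrtr.
have q4 : q ^+ 4 = (#|` E|)%:R by exact: powRV4_exp4.
rewrite -s2; apply: quadratic_root_le => //.
(* With v = q^3 / s one gets kv = sq^3 and n/v = sq, the shape of [quadratic_root_le]. *)
have /(max_sidon_card_quadratic kE) : 0 < q ^+ 3 / s by rewrite divr_gt0 // exprn_gt0.
rewrite -s2 -q4.
rewrite (_ : s ^+ 2 * _ = s * q ^+ 3); last by field; rewrite gt_eqF.
by rewrite (_ : q ^+ 4 / _ = s * q) //; field; rewrite !gt_eqF.
Qed.

(* beta is the positive root of x^2 = 2 + 2 alpha x, the limit case kappa = 0
   with r = x m. *)
Lemma root_perturbation (alpha kappa m r : R)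
    (beta := alpha + Num.sqrt (2 + alpha ^+ 2)) :
  0 < alpha -> 0 <= kappa -> 0 < m ->
  r ^+ 2 <= m ^+ 2 + (alpha + kappa) * m * (m / alpha)
    + r * (m ^+ 2 / (m / alpha) + (alpha + kappa) * m) ->
  r <= beta * m + kappa * (1 + alpha^-1 + beta) * m.
Proof.
move=> a0 ka0 m0.
have g2 : Num.sqrt (2 + alpha ^+ 2) ^+ 2 = 2 + alpha ^+ 2.
  by rewrite sqr_sqrtr // addr_ge0 // sqr_ge0.
have g0 : 0 <= Num.sqrt (2 + alpha ^+ 2) by exact: sqrtr_ge0.
have g1 : 1 <= Num.sqrt (2 + alpha ^+ 2) by nra.
have -> : m ^+ 2 / (m / alpha) = alpha * m by field; rewrite !gt_eqF.
have -> : (alpha + kappa) * m * (m / alpha) = m ^+ 2 + kappa * m ^+ 2 * alpha^-1.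
  by field; rewrite gt_eqF.
have ia0 : 0 < alpha^-1 by rewrite invr_gt0.
move: (Num.sqrt _) @beta g2 g0 g1 (alpha^-1) ia0 => g /= g2 g0 g1 ia ia0 h.
rewrite leNgt; apply/negP => lt.
pose t := r / m - alpha - g.
have rE : r = (alpha + g + t) * m by rewrite /t; field; rewrite gt_eqF.
have tk : kappa * (1 + ia + (alpha + g)) < t.
  by move: lt; rewrite rE -mulrDl (ltr_pM2r m0); lra.
move: h; rewrite leNgt => /negP; apply; rewrite rE -subr_gt0.
(* The first bracket is positive by [tk], the last vanishes as g^2 = 2 + alpha^2, and the others are
   nonnegative since [kappa <= t] and [1 <= g]. *)
rewrite (_ : _ - _ = m ^+ 2 * ((t - kappa * (1 + ia + (alpha + g)))
  + kappa + t * (t - kappa) + (2 * g - 1) * t + (g ^+ 2 - 2 - alpha ^+ 2))); last by ring.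
rewrite mulr_gt0 ?exprn_gt0 // g2.
have t0 : 0 <= t by apply: le_trans (ltW tk); rewrite mulr_ge0 //; lra.
have kt : kappa <= t by apply: le_trans (ltW tk); rewrite ler_peMr //; lra.
have : 0 <= t * (t - kappa) by rewrite mulr_ge0 // subr_ge0.
have : 0 <= (2 * g - 1) * t by rewrite mulr_ge0 //; lra.
lra.
Qed.

(** Here [kappa] bounds the excess of k / sqrt n over its limsup [alpha]; the error is linear in it,
    so it vanishes with it. *)
Lemma max_sidon_card_le_linear k E (alpha kappa : R) :
  0 < alpha -> 0 <= kappa -> union_of_intervals k E -> (0 < #|` E|)%N ->
  k%:R <= (alpha + kappa) * Num.sqrt (#|` E|)%:R ->
  (max_sidon_card E)%:R
    <= (alpha + Num.sqrt (2 + alpha ^+ 2)) * Num.sqrt (#|` E|)%:R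
      + kappa * (1 + alpha^-1 + (alpha + Num.sqrt (2 + alpha ^+ 2)))
        * Num.sqrt (#|` E|)%:R.
Proof.
move=> a0 ka0 kE E0; set m := Num.sqrt (#|` E|)%:R => km.
have m0 : 0 < m by rewrite sqrtr_gt0 ltr0n.
have m2 : m ^+ 2 = (#|` E|)%:R by rewrite sqr_sqrtr.
apply: root_perturbation => //.
have v0 : 0 < m / alpha by rewrite divr_gt0.
apply: le_trans (max_sidon_card_quadratic kE v0) _; rewrite m2.
rewrite lerD ?ler_wpM2l ?lerD2l ?ler0n //.
by rewrite ler_wpM2r // ltW.
Qed.

(** The limsup is an infimum of suprema over neighbourhoods of infinity; one of these suprema is
    already below [l + e]. *)
Lemma limn_esup_near_le (u : nat -> R) (l e : R) :
  limn_esup (fun n => (u n)%:E) = l%:E -> 0 < e ->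
  \forall n \near \oo, u n <= l + e.
Proof.
move=> ul e0; have : (limn_esup (fun n => (u n)%:E) < (l + e)%:E)%E.
  by rewrite ul lte_fin ltrDl.
move=> /ereal_inf_lt[_ [V Voo <-] supV]; apply: filterS Voo => n Vn.
rewrite -lee_fin; apply: le_trans (ltW supV).
by apply: ereal_sup_ubound; exists n.
Qed.

End Bounds.

(** * Asymptotic statements, with error terms depending on [k] and [n] only *)

Theorem theorem2 (R : realType) (k : nat -> nat)
    (k_gt0 : forall n, (0 < n)%N -> (0 < k n)%N) :
  (forall alpha : R, 0 < alpha ->
     limn_esup (fun n => ((k n)%:R / Num.sqrt n%:R)%:E) = alpha%:E ->
     exists f : nat -> R,
       f =o_\oo (fun n => Num.sqrt n%:R : R) /\
       forall E, interval_union_sequence k E -> forall n, (0 < n)%N ->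
         (max_sidon_card (E n))%:R
           <= (alpha + Num.sqrt (2 + alpha ^+ 2)) * Num.sqrt n%:R + f n)
  /\
  ((fun n => (k n)%:R : R) =o_\oo (fun n => Num.sqrt n%:R : R) ->
     exists f : nat -> R,
       f =o_\oo (fun n => Num.sqrt n%:R : R) /\
       forall E, interval_union_sequence k E -> forall n, (0 < n)%N ->
         (max_sidon_card (E n))%:R <= Num.sqrt n%:R + f n)
  /\
  ((fun n => (k n)%:R : R) =o_\oo (fun n => n%:R `^ 4^-1 : R) ->
     exists f : nat -> R,
       f =o_\oo (fun n => n%:R `^ 4^-1 : R) /\
       forall E, interval_union_sequence k E -> forall n, (0 < n)%N ->
         (max_sidon_card (E n))%:R
           <= Num.sqrt n%:R + Num.sqrt (k n)%:R * n%:R `^ 4^-1 + f n).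
Proof.
split; last split.
- move=> alpha a0 lim_k.
  pose u n : R := (k n)%:R / Num.sqrt n%:R.
  (* The truncation at 0 is needed because a limsup does not keep [u n] from staying far below
     [alpha]. *)
  pose kappa n : R := Num.max 0 (u n - alpha).
  pose c : R := 1 + alpha^-1 + (alpha + Num.sqrt (2 + alpha ^+ 2)).
  have c0 : 0 < c by rewrite !addr_gt0 ?invr_gt0 ?sqrtr_gt0 ?addr_gt0 ?exprn_gt0.
  have kappa0 n : 0 <= kappa n by rewrite le_max lexx.
  exists (fun n => kappa n * c * Num.sqrt n%:R); split.
    apply/eqoP => e e0.
    have := limn_esup_near_le lim_k (divr_gt0 e0 c0).
    apply: filterS => n un.
    rewrite normrM ler_wpM2r // ger0_norm ?mulr_ge0 ?(ltW c0) //.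
    by rewrite -ler_pdivlMr // ge_max (ltW (divr_gt0 e0 c0)) lerBlDl.
  move=> E kE n n0; have [cE unE] := kE n n0.
  have := @max_sidon_card_le_linear R _ _ _ (kappa n) a0 (kappa0 n) unE.
  rewrite cE; apply => //.
  rewrite -ler_pdivrMr ?sqrtr_gt0 ?ltr0n // -lerBlDl.
  by rewrite le_max lexx orbT.
- move=> /eqoP k_o.
  exists (fun n => Num.sqrt (k n)%:R * n%:R `^ 4^-1 + (k n)%:R); split.
    apply/eqoP => e e0.
    have [d d0 ed] : exists2 d, 0 < d & e = d + d.
      by exists (e / 2); [rewrite divr_gt0 | field].
    near=> n.
    have kd : (k n)%:R <= d * Num.sqrt n%:R.
      have : `|(k n)%:R : R| <= d * `|Num.sqrt n%:R| by near: n; exact: k_o.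
      by rewrite normr_nat ger0_norm ?sqrtr_ge0.
    (* The square of [d] prepares the root: sqrt k <= d n^(1/4), so the mixed term is at most d sqrt
       n. *)
    have kd2 : (k n)%:R <= d ^+ 2 * Num.sqrt n%:R.
      have : `|(k n)%:R : R| <= d ^+ 2 * `|Num.sqrt n%:R|.
        by near: n; apply: k_o; exact: exprn_gt0.
      by rewrite normr_nat ger0_norm ?sqrtr_ge0.
    rewrite !ger0_norm ?addr_ge0 ?mulr_ge0 ?sqrtr_ge0 ?powR_ge0 //.
    rewrite ed mulrDl lerD //.
    have q0 : 0 <= (n%:R : R) `^ 4^-1 by exact: powR_ge0.
    rewrite -(powRV4_sqr R n) expr2 mulrA ler_wpM2r //.
    rewrite -(ler_pXn2r (_ : 0 < 2)%N) ?nnegrE ?sqrtr_ge0 ?mulr_ge0 ?(ltW d0) //.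
    by rewrite sqr_sqrtr // exprMn powRV4_sqr.
  move=> E kE n n0; have [cE unE] := kE n n0.
  have := @max_sidon_card_le R _ _ unE (k_gt0 _ n0).
  by rewrite cE addrA; apply.
- move=> k_o; exists (fun n => (k n)%:R); split=> // E kE n n0.
  have [cE unE] := kE n n0.
  have := @max_sidon_card_le R _ _ unE (k_gt0 _ n0).
  by rewrite cE; apply.
Unshelve. all: by end_near.
Qed.
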